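(* Let $(\mathcal{A},\mu,\alpha)$ be a commutative Hom-associative algebra, and write $xy=\mu(x,y)$. Let $\partial:\mathcal{A}\to\mathcal{A}$ be a linear map commuting with $\alpha$ (that is, $\partial\alpha=\alpha\partial$) and satisfying $$\partial(x\,\partial(y))=\partial(x)\,\partial(y)\quad\text{for all }x,y\in\mathcal{A}.$$ Define $x\star y=x\,\partial(y)$ for all $x,y\in\mathcal{A}$. Then $(\mathcal{A},\star,\alpha)$ is a Hom-Novikov algebra.
   Context: All vector spaces are over a field $\mathbb{F}$ of characteristic zero. A Hom-associative algebra is a triple $(V,\mu,\alpha)$ with $V$ a vector space, $\mu:V\times V\to V$ bilinear, $\mu(x,y)=xy$, and $\alpha:V\to V$ a linear map such that $\alpha(x)(yz)=(xy)\alpha(z)$ for all $x,y,z\in V$; it is commutative if $xy=yx$ for all $x,y$. A Hom-Novikov algebra is a triple $(\mathcal{A},\mu,\alpha)$ consisting of a vector space $\mathcal{A}$, a bilinear map $\mu:\mathcal{A}\times\mathcal{A}\to\mathcal{A}$, $\mu(x,y)=xy$, and an algebra homomorphism $\alpha:\mathcal{A}\to\mathcal{A}$ (linear with $\alpha(xy)=\alpha(x)\alpha(y)$) such that for all $x,y,z\in\mathcal{A}$: $(xy)\alpha(z)=(xz)\alpha(y)$ and $(xy)\alpha(z)-\alpha(x)(yz)=(yx)\alpha(z)-\alpha(y)(xz)$.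
   Formalization: The formal theorem also assumes α(xy)=α(x)α(y); without it the claim fails, e.g. for A=F with its usual product, α=2·id, ∂=id, where α(x⋆y)=2xy but α(x)⋆α(y)=4xy, so α is not an algebra homomorphism for ⋆. *)

(* Defs.v *)
From mathcomp Require Import all_boot all_algebra.

Set Implicit Arguments.
Unset Strict Implicit.
Unset Printing Implicit Defensive.

Import GRing.Theory.
Local Open Scope ring_scope.

(* The twisting map of a Hom-associative algebra is only required to be linear,
   whereas that of a Hom-Novikov algebra is an algebra endomorphism. *)

Record hom_associative (F : fieldType) (V : lmodType F)
    (mu : V -> V -> V) (alpha : V -> V) : Prop := HomAssociative {
  hom_assoc_bilinear : bilinear_for *:%R *:%R mu;
  hom_assoc_linear : linear alpha;
  hom_assocA : forall x y z, mu (alpha x) (mu y z) = mu (mu x y) (alpha z)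
}.

Record hom_novikov (F : fieldType) (A : lmodType F)
    (mu : A -> A -> A) (alpha : A -> A) : Prop := HomNovikov {
  hom_novikov_bilinear : bilinear_for *:%R *:%R mu;
  hom_novikov_linear : linear alpha;
  hom_novikov_morph : {morph alpha : x y / mu x y};
  hom_novikov_right_comm : forall x y z,
    mu (mu x y) (alpha z) = mu (mu x z) (alpha y);
  hom_novikov_left_sym : forall x y z,
    mu (mu x y) (alpha z) - mu (alpha x) (mu y z)
    = mu (mu y x) (alpha z) - mu (alpha y) (mu x z)
}.

Definition star (A : Type) (mu : A -> A -> A) (d : A -> A) (x y : A) : A :=
  mu x (d y).

(* Main.v *)
Require Import Defs.
From mathcomp Require Import all_boot all_algebra.
Import GRing.Theory.
Local Open Scope ring_scope.

(** Since [d] commutes with [alpha], Hom-associativity rewrites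
    [(x d(y)) d(alpha z)] as [alpha x (d(y) d(z))]. This is symmetric in [y]
    and [z] by commutativity, which is right commutativity of the new product.
    The hypothesis on [d] turns [alpha x d(y d(z))] into the same element, so
    the new product is itself Hom-associative: every associator vanishes, and
    left symmetry reduces to [0 = 0]. *)

Section StarProduct.

Variables (F : fieldType) (A : lmodType F).
Variables (mu : A -> A -> A) (alpha d : A -> A).

Lemma star_bilinear :
  bilinear_for *:%R *:%R mu -> linear d -> bilinear_for *:%R *:%R (star mu d).
Proof.
move=> [mu_linl mu_linr] d_lin; split=> [y a u v | x a u v]; rewrite /star.
  exact: mu_linl.
by rewrite d_lin; apply: mu_linr.
Qed.

Hypothesis homA : hom_associative mu alpha.
Hypothesis d_alpha : forall x, d (alpha x) = alpha (d x).

Lemma star_star_alpha x y z :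
  star mu d (star mu d x y) (alpha z) = mu (alpha x) (mu (d y) (d z)).
Proof. by rewrite /star d_alpha (hom_assocA homA). Qed.

Lemma star_hom_assoc x y z :
    (forall u v, d (mu u (d v)) = mu (d u) (d v)) ->
  star mu d (alpha x) (star mu d y z) = star mu d (star mu d x y) (alpha z).
Proof. by move=> d_mu; rewrite star_star_alpha /star d_mu. Qed.

End StarProduct.

Theorem theorem3p6 (F : fieldType) (charF0 : [pchar F] =i pred0)
    (A : lmodType F) (mu : A -> A -> A) (alpha : A -> A)
    (homA : hom_associative mu alpha)
    (muC : commutative mu)
    (* multiplicativity of alpha: implicit in the source, and necessary, since
       alpha has to be an algebra endomorphism in the conclusion *)
    (alphaM : {morph alpha : x y / mu x y})
    (d : A -> A) (d_lin : linear d)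
    (d_alpha : forall x, d (alpha x) = alpha (d x))
    (d_mu : forall x y, d (mu x (d y)) = mu (d x) (d y)) :
  hom_novikov (star mu d) alpha.
Proof.
split.
- exact: star_bilinear (hom_assoc_bilinear homA) d_lin.
- exact: hom_assoc_linear homA.
- by move=> x y; rewrite /star alphaM d_alpha.
- move=> x y z; rewrite !(star_star_alpha _ _ _ _ _ homA d_alpha).
  by rewrite (muC (d y)).
- by move=> x y z; rewrite !(star_hom_assoc _ _ _ _ _ homA d_alpha) // !subrr.
Qed.
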